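(* Let $f:\mathbb{N}\to\mathbb{R}$ be an arithmetic function all of whose values have the same sign, and let $S(n)=\sum_{k=1}^{n} f(k)$. Then, as $n\to\infty$, $$\left(\left(\sum_{k=1}^{n} f(k)\right)^2-\sum_{k=1}^{n} f^2(k)\right)\left(\frac{1}{n(n-1)}-\frac{1}{n^2}\right)=\frac{O(S^2(n))}{n^3}.$$
   Context: $S^2(n)$ means $(S(n))^2$ and $f^2(k)$ means $(f(k))^2$. *)

(* Defs.v *)
From mathcomp Require Export all_boot all_order all_algebra.
From mathcomp Require Export all_classical all_reals all_analysis.
Set Implicit Arguments.
Unset Strict Implicit.
Unset Printing Implicit Defensive.
Import Order.TTheory GRing.Theory Num.Theory.
Local Open Scope ring_scope.

(* Arithmetic functions live on the positive integers; [nat] also contains 0,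
   so the value [f 0] is never constrained nor used. A function with constant
   sign may vanish at some points (e.g. the indicator of the primes). *)
Definition same_sign (R : realType) (f : nat -> R) : Prop :=
  (forall k : nat, (0 < k)%N -> 0 <= f k) \/
  (forall k : nat, (0 < k)%N -> f k <= 0).

Definition summatory (R : realType) (f : nat -> R) (n : nat) : R :=
  \sum_(1 <= k < n.+1) f k.

(* Main.v *)
Require Import Defs.
From mathcomp Require Import all_boot all_order all_algebra.
From mathcomp Require Import all_classical all_reals all_analysis.
From mathcomp Require Import ring lra.
Import Order.TTheory GRing.Theory Num.Theory.
Import numFieldNormedType.Exports.
Local Open Scope classical_set_scope.
Local Open Scope ring_scope.

(** Put [S = f 1 + ... + f n] and [Q = f 1 ^ 2 + ... + f n ^ 2].  Since
    [1 / (n (n - 1)) - 1 / n ^ 2 = (n / (n - 1)) / n ^ 3] for [n >= 2], the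
    function to be estimated is [g n = (S ^ 2 - Q) * (n / (n - 1))].  Expanding
    [S ^ 2] gives [Q] plus the cross products [f i * f j] with [i <> j], which
    are nonnegative because all values of [f] have the same sign; hence
    [0 <= S ^ 2 - Q <= S ^ 2] ([sum_sqr_le_sqr_sum],
    [sum_sqr_le_sqr_summatory]).  As [n / (n - 1) <= 2] for [n >= 2], this
    yields [|g n| <= 2 * S ^ 2]. *)

(** By induction on the list: adjoining a term [x] to a sum [s] adds [x ^ 2] on
    the left, and [x ^ 2 + 2 x s] with [x s >= 0] on the right; the sign of [s]
    has to be carried along. *)
Lemma sum_sqr_le_sqr_sum (R : realDomainType) (I : Type) (r : seq I)
    (P : pred I) (F : I -> R) :
  (forall i, P i -> 0 <= F i) ->
  \sum_(i <- r | P i) F i ^+ 2 <= (\sum_(i <- r | P i) F i) ^+ 2.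
Proof.
move=> F0.
suff [] : 0 <= \sum_(i <- r | P i) F i /\
  \sum_(i <- r | P i) F i ^+ 2 <= (\sum_(i <- r | P i) F i) ^+ 2 by [].
elim/big_rec2: _ => [|i s q /F0 Fi0 [q0 sq]]; first by rewrite expr0n.
by split; [exact: addr_ge0 | have := mulr_ge0 Fi0 q0; nra].
Qed.

Lemma sum_sqr_le_sqr_summatory (R : realType) (f : nat -> R) (n : nat) :
  same_sign f -> \sum_(1 <= k < n.+1) f k ^+ 2 <= summatory f n ^+ 2.
Proof.
rewrite /summatory big_nat_cond [X in _ <= X ^+ 2]big_nat_cond => -[f0|f0].
  by apply: sum_sqr_le_sqr_sum => k /andP[/andP[k0 _] _]; exact: f0.
(* Both sides are unchanged when [f] is replaced by [- f]. *)
rewrite -sqrrN -sumrN.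
under eq_bigr do rewrite -sqrrN.
by apply: sum_sqr_le_sqr_sum => k /andP[/andP[k0 _] _]; rewrite oppr_ge0 f0.
Qed.

Theorem mainTheorem3 (R : realType) (f : nat -> R) (hf : same_sign f) :
  exists2 g : nat -> R,
    g =O_ \oo (fun n : nat => summatory f n ^+ 2) &
    forall n : nat, (1 < n)%N ->
      ((\sum_(1 <= k < n.+1) f k) ^+ 2 - \sum_(1 <= k < n.+1) f k ^+ 2)
        * (1 / (n%:R * (n%:R - 1)) - 1 / n%:R ^+ 2)
      = g n / n%:R ^+ 3.
Proof.
exists (fun n => (summatory f n ^+ 2 - \sum_(1 <= k < n.+1) f k ^+ 2)
  * (n%:R / (n%:R - 1))); last first.
  move=> n n1; have nR : 1 < n%:R :> R by rewrite ltr1n.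
  by rewrite /summatory; field; apply/andP; split; lra.
apply/eqOP; near=> c; near=> n.
have nR : 2 <= n%:R :> R by rewrite ler_nat; near: n; exists 2%N.
have QS := @sum_sqr_le_sqr_summatory R f n hf.
have Q0 : 0 <= \sum_(1 <= k < n.+1) f k ^+ 2.
  by apply: sumr_ge0 => k _; exact: sqr_ge0.
have t0 : 0 <= n%:R / (n%:R - 1) :> R by apply: divr_ge0; lra.
have t2 : n%:R / (n%:R - 1) <= 2 :> R by rewrite ler_pdivrMr; lra.
have c2 : 2 <= c by near: c; apply: nbhs_pinfty_ge; rewrite num_real.
have S0 := sqr_ge0 (summatory f n).
have D0 : 0 <= summatory f n ^+ 2 - \sum_(1 <= k < n.+1) f k ^+ 2.
  by rewrite subr_ge0.
rewrite (ger0_norm (mulr_ge0 D0 t0)) (ger0_norm S0) mulrC.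
by apply: ler_pM => //; [exact: le_trans c2 | rewrite gerBl].
Unshelve. all: by end_near. Qed.
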